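(* Let $\rho$ be a quantum state on a complex Hilbert space of finite dimension $d$. The maximal conditional (von Neumann) entropy that can be extracted from $\rho$ using a projective measurement is $$H^*=\log_2 d-S(\rho),$$ where $S(\rho)=-\operatorname{tr}(\rho\log_2\rho)$. That is, $\max_{\mathcal{M}}H(Z|E)=\log_2 d-S(\rho)$, the maximum being over all projective measurements $\mathcal{M}=\{M_z\}_z$, where $H(Z|E)$ is the entropy of the outcome $Z$ of $\mathcal{M}$ on $\rho$ conditioned on the purifying system $E$.
   Context: A quantum state on a finite-dimensional Hilbert space $\mathcal{H}_A$ is a positive semidefinite operator of trace one. A projective measurement on $\mathcal{H}_A$ is a finite family $\mathcal{M}=\{M_z\}_z$ of positive semidefinite operators with $M_zM_{z'}=\delta_{zz'}M_z$ and $\sum_zM_z=\mathbb{1}$ (projectors of any rank). Let $|\Psi\rangle_{AE}\in\mathcal{H}_A\otimes\mathcal{H}_E$ be a purification of $\rho$, i.e. a unit vector with $\operatorname{tr}_E|\Psi\rangle\langle\Psi|=\rho$; the adversary Eve holds $E$. Measuring $\mathcal{M}$ on $A$ yields the classical-quantum state $$\rho_{ZE}=\sum_z p_z\,|z\rangle\langle z|\otimes\rho_E^z,\qquad p_z=\operatorname{tr}(M_z\rho),\qquad \rho_E^z=\frac{1}{p_z}\operatorname{tr}_A\big[(M_z\otimes\mathbb{1}_E)|\Psi\rangle\langle\Psi|\big],$$ (terms with $p_z=0$ omitted), where $\{|z\rangle\}_z$ is an orthonormal family. The von Neumann entropy is $S(\sigma)=-\operatorname{tr}(\sigma\log_2\sigma)$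 with $0\log_2 0=0$, and the conditional entropy is $H(Z|E)=S(\rho_{ZE})-S(\rho_E)$ with $\rho_E=\operatorname{tr}_Z\rho_{ZE}$. *)

(* Defs.v *)
From HB Require Import structures.
From mathcomp Require Import all_boot all_order all_algebra.
From mathcomp Require Import spectral sesquilinear complex mxtens.
From mathcomp Require Import reals exp.

Set Implicit Arguments.
Unset Strict Implicit.
Unset Printing Implicit Defensive.

Import Order.TTheory GRing.Theory Num.Theory.
Local Open Scope ring_scope.
Local Open Scope complex_scope.

Section QuantumDefs.
Variable R : realType.
Local Notation C := (R[i]).

(* An operator on C^n is a matrix acting on column vectors. *)
Definition adjmx m n (A : 'M[C]_(m, n)) : 'M[C]_(n, m) :=
  map_mx Num.conj A^T.

(* The order of R[i] makes 0 <= z mean "z is real and nonnegative". *)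
Definition psdmx n (A : 'M[C]_n) : Prop :=
  forall v : 'cV[C]_n, 0 <= (adjmx v *m A *m v) 0 0.

Definition quantum_state n (rho : 'M[C]_n) : Prop :=
  psdmx rho /\ \tr rho = 1.

(* In particular some of the M z may vanish. *)
Definition projective_measurement n m (M : 'I_m -> 'M[C]_n) : Prop :=
  [/\ forall z, psdmx (M z),
      forall z z', M z *m M z' = if z == z' then M z else 0
    & \sum_z M z = 1%:M].

(* C^m (x) C^n is C^(m * n), indexed through mxtens_index as for the Kronecker
   product *t. *)
Definition ptrace1 m n (X : 'M[C]_(m * n)) : 'M[C]_n :=
  \matrix_(k, l) \sum_(i < m) X (mxtens_index (i, k)) (mxtens_index (i, l)).

Definition ptrace2 m n (X : 'M[C]_(m * n)) : 'M[C]_m :=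
  \matrix_(i, j) \sum_(k < n) X (mxtens_index (i, k)) (mxtens_index (j, k)).

Definition ketbra n (psi : 'cV[C]_n) : 'M[C]_n := psi *m adjmx psi.

Definition purification d e (rho : 'M[C]_d) (Psi : 'cV[C]_(d * e)) : Prop :=
  (adjmx Psi *m Psi) 0 0 = 1 /\ ptrace2 (ketbra Psi) = rho.

(* ln x = 0 for x <= 0, hence log2 0 = 0 and 0 * log2 0 = 0. *)
Definition log2 (x : R) : R := ln x / ln 2.

(* Functional calculus: for Hermitian A = P^-1 *m diag_mx D *m P with P unitary
   and D real, log2mx A = P^-1 *m diag_mx (log2 D) *m P; the eigenvalue 0 is
   sent to 0. The value is meaningless for non-Hermitian A. *)
Definition log2mx n (A : 'M[C]_n) : 'M[C]_n :=
  invmx (spectralmx A)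
  *m diag_mx (map_mx (fun x : C => (log2 (complex.Re x))%:C) (spectral_diag A))
  *m spectralmx A.

(* The trace is real when sigma is positive semidefinite. *)
Definition vN_entropy n (sigma : 'M[C]_n) : R :=
  - complex.Re (\tr (sigma *m log2mx sigma)).

Section Measurement.
Variables (d e m : nat) (M : 'I_m -> 'M[C]_d) (Psi : 'cV[C]_(d * e)).

(* p_z = tr (M_z rho), with rho = tr_E |Psi><Psi| the state purified by Psi. *)
Definition outcome_prob (z : 'I_m) : C := \tr (M z *m ptrace2 (ketbra Psi)).

Definition cond_state (z : 'I_m) : 'M[C]_e :=
  (outcome_prob z)^-1 *: ptrace1 ((M z *t 1%:M) *m ketbra Psi).

(* The classical register is C^m, with |z> the standard basis. *)
Definition cq_state : 'M[C]_(m * e) :=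
  \sum_(z | outcome_prob z != 0)
    outcome_prob z *: (delta_mx z z *t cond_state z).

Definition cond_entropy : R :=
  vN_entropy cq_state - vN_entropy (ptrace1 cq_state).

End Measurement.
End QuantumDefs.

(* Main.v *)
(* Write Psi as the d x e matrix K of its coefficients, so rho = K K^*. Let G be
   the matrix with rows indexed by (z, k) and entries (M_z K)_(i, k). Then
   rho_ZE = G G^*, while G^* G is the transpose of the post-measurement state
   N = sum_z M_z rho M_z, and rho_E = (K^* K)^T. As A B and B A have the same
   nonzero eigenvalues with multiplicities, H(Z|E) = S(N) - S(rho), and
   S(N) <= log2 d. Equality holds for N = 1/d, which is obtained by measuring in
   a basis unbiased with respect to an eigenbasis of rho, namely the discrete
   Fourier transform of that eigenbasis. *)

Require Import Defs.
From HB Require Import structures.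
From mathcomp Require Import all_boot all_order all_algebra.
From mathcomp Require Import spectral sesquilinear complex mxtens.
From mathcomp Require Import reals exp lra ring.
From mathcomp Require Import separable cyclic cyclotomic.

Set Implicit Arguments.
Unset Strict Implicit.
Unset Printing Implicit Defensive.

Import Order.TTheory GRing.Theory Num.Theory.
Local Open Scope ring_scope.

(** * Characteristic polynomials and roots of unity *)

(** Two column eliminations on the block matrix with rows [X, A] and [B, 1] give its determinant:
    one clears [B], the other scales the second block column by [X] and clears [A]. *)
Lemma char_poly_mulmxC (F : comNzRingType) m n (A : 'M[F]_(m, n)) (B : 'M_(n, m)) :
  'X^n * char_poly (A *m B) = 'X^m * char_poly (B *m A).
Proof.
rewrite /char_poly /char_poly_mx !map_mxM /=.
set A' := map_mx _ A; set B' := map_mx _ B.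
pose X k : 'M[{poly F}]_k := 'X%:M.
pose M := block_mx (X m) A' B' 1%:M.
have detM : \det M = \det (X m - A' *m B').
  transitivity (\det (M *m block_mx 1%:M 0 (- B') 1%:M)).
    by rewrite det_mulmx det_lblock !det1 !mulr1.
  rewrite mulmx_block !mulmx1 !mulmx0 !mul1mx !add0r mulmxN.
  by rewrite subrr det_ublock det1 mulr1.
have detX k : \det (X k) = 'X^k by rewrite det_scalar.
rewrite -detM -!detX mulrC.
transitivity (\det (M *m block_mx 1%:M (- A') 0 (X n))).
  by rewrite det_mulmx det_ublock det1 mul1r.
rewrite mulmx_block !mulmx1 !mulmx0 !addr0 mulmxN mul1mx.
rewrite /X scalar_mxC addNr det_lblock mulmxN.
by rewrite addrC.
Qed.

Lemma char_poly_trmx (F : comNzRingType) n (A : 'M[F]_n) :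
  char_poly A^T = char_poly A.
Proof.
rewrite /char_poly -det_tr; congr (\det _).
by apply/matrixP=> i j; rewrite !mxE eq_sym.
Qed.

(** In characteristic zero [X^n - 1] is separable, so it has [n] distinct roots, and [n] distinct
    [n]-th roots of unity in a field include a primitive one. *)
Lemma prim_root_exists (C : numClosedFieldType) n :
  (n > 0)%N -> exists z : C, n.-primitive_root z.
Proof.
pose p : {poly C} := 'X^n - 1; have [r Dp] := closed_field_poly_normal p.
move=> n_gt0; rewrite (monicP _) ?monicXnsubC // scale1r in Dp.
have rn1 : all n.-unity_root r by apply/allP=> z; rewrite -root_prod_XsubC -Dp.
have sz_r : (n < (size r).+1)%N.
  by rewrite -(size_prod_XsubC r id) -Dp size_XnsubC.
have [|z] := hasP (has_prim_root n_gt0 rn1 _ sz_r); last by exists z.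
by rewrite -separable_prod_XsubC -Dp separable_Xn_sub_1 // pnatr_eq0 -lt0n.
Qed.

(** * Entropy through eigenvalues *)

Section Spectrum.
Variable R : realType.
Local Notation C := (R[i]).

Definition eta (x : C) : R := complex.Re x * log2 (complex.Re x).

Lemma eta0 : eta 0 = 0.
Proof. by rewrite /eta /= mul0r. Qed.

(** With [A = P^-1 (D P)], exchanging the factors gives [D P P^-1 = D]; the common factor [X^n]
    cancels. *)
Lemma char_poly_normalmx n (A : 'M[C]_n) : A \is normalmx ->
  char_poly A = \prod_(x <- [seq spectral_diag A 0 i | i : 'I_n]) ('X - x%:P).
Proof.
move=> /orthomx_spectralP {1}->; apply: (@mulfI _ 'X^n).
  by rewrite monic_neq0 // monicXn.
rewrite -mulmxA char_poly_mulmxC mulmxK ?spectral_unit //; congr (_ * _).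
rewrite char_poly_trig ?diag_mx_is_trig // big_image /=.
by apply: eq_bigr => i _; rewrite mxE eqxx.
Qed.

Lemma ReM_real (z : C) (r : R) :
  complex.Re (z * r%:C%C) = complex.Re z * r.
Proof. by case: z => a b /=; rewrite mulr0 subr0. Qed.

Lemma Re_sum (I : finType) (F : I -> C) :
  complex.Re (\sum_i F i) = \sum_i complex.Re (F i).
Proof. by apply: (big_morph (@complex.Re R)) => // -[a b] [c e]. Qed.

Lemma vN_entropyE n (A : 'M[C]_n) : A \is normalmx ->
  vN_entropy A = - \sum_i eta (spectral_diag A 0 i).
Proof.
move=> /orthomx_spectralP eqA; rewrite /vN_entropy {1}eqA; congr (- _).
rewrite /log2mx; set P := spectralmx A; set L := diag_mx (map_mx _ _).
have PP : P *m invmx P = 1%:M by rewrite mulmxV ?spectral_unit.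
rewrite !mulmxA mxtrace_mulC !mulmxA PP mul1mx -[_ *m P *m _]mulmxA PP mulmx1.
rewrite mulmx_diag mxtrace_diag Re_sum; apply: eq_bigr => i _.
by rewrite !mxE ReM_real.
Qed.

(** Unique factorization into linear factors makes the two spectra agree once padded with [n] and
    [m] zeros, and [eta] vanishes at 0. *)
Lemma vN_entropy_char_poly m n (A : 'M[C]_m) (B : 'M[C]_n) :
  A \is normalmx -> B \is normalmx ->
  'X^n * char_poly A = 'X^m * char_poly B -> vN_entropy A = vN_entropy B.
Proof.
move=> nA nB; rewrite !char_poly_normalmx //.
have XnE k : 'X^k = \prod_(x <- nseq k (0 : C)) ('X - x%:P).
  rewrite big_nseq subr0.
  by elim: k => //= k IHk; rewrite exprS IHk.
rewrite !XnE -!big_cat /= => /prod_XsubC_eq eq_spec.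
have etaE k l (D : 'rV[C]_l) :
  \sum_i eta (D 0 i) = \sum_(x <- nseq k 0 ++ [seq D 0 i | i : 'I_l]) eta x.
  rewrite big_cat big_nseq big_image /= -[LHS]add0r; congr (_ + _).
  by elim: k => //= k <-; rewrite eta0 addr0.
by rewrite !vN_entropyE // (etaE n) (etaE m) (perm_big _ eq_spec).
Qed.

Lemma spectralmx_diag n (A : 'M[C]_n) : A \is normalmx ->
  spectralmx A *m A *m invmx (spectralmx A) = diag_mx (spectral_diag A).
Proof.
move=> /orthomx_spectralP; set P := spectralmx A; set D := spectral_diag A => ->.
by rewrite !mulmxA mulmxV ?spectral_unit // mul1mx mulmxK ?spectral_unit.
Qed.

Lemma mxtrace_spectral n (A : 'M[C]_n) : A \is normalmx ->
  \tr A = \sum_i spectral_diag A 0 i.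
Proof.
move=> /orthomx_spectralP {1}->.
by rewrite -mulmxA mxtrace_mulC mulmxK ?spectral_unit // mxtrace_diag.
Qed.

Lemma vN_entropy_scalar n (c : R) :
  vN_entropy ((c%:C)%C%:M : 'M[C]_n) = - (n%:R * (c * log2 c)).
Proof.
set A := _%:M.
have nA : A \is normalmx.
  by apply/normalmxP; rewrite tr_scalar_mx map_scalar_mx -!scalar_mxM mulrC.
have := spectralmx_diag nA; rewrite {2}/A scalar_mxC -mulmxA.
rewrite mulmxV ?spectral_unit // mulmx1 => eqD.
rewrite vN_entropyE //; congr (- _).
rewrite (eq_bigr (fun=> c * log2 c)) ?sumr_const ?card_ord ?mulr_natl // => i _.
by move/matrixP/(_ i i): eqD; rewrite !mxE eqxx !mulr1n => <-.
Qed.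

Lemma adjmxK m n (A : 'M[C]_(m, n)) : adjmx (adjmx A) = A.
Proof. exact: trmxCK. Qed.

Lemma adjmx_mul m n p (A : 'M[C]_(m, n)) (B : 'M[C]_(n, p)) :
  adjmx (A *m B) = adjmx B *m adjmx A.
Proof. by rewrite /adjmx trmx_mul map_mxM. Qed.

Lemma normalmx_gram m n (A : 'M[C]_(m, n)) : A *m adjmx A \is normalmx.
Proof.
by apply/normalmxP; rewrite -[map_mx _ _]/(adjmx _) adjmx_mul adjmxK.
Qed.

Lemma normalmx_gramC m n (A : 'M[C]_(m, n)) : adjmx A *m A \is normalmx.
Proof. by rewrite -{2}[A]adjmxK normalmx_gram. Qed.

Lemma vN_entropy_gramC m n (A : 'M[C]_(m, n)) :
  vN_entropy (A *m adjmx A) = vN_entropy (adjmx A *m A).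
Proof.
apply: vN_entropy_char_poly; last exact: char_poly_mulmxC.
  exact: normalmx_gram.
exact: normalmx_gramC.
Qed.

Lemma normalmx_trmx n (A : 'M[C]_n) : A \is normalmx -> A^T \is normalmx.
Proof.
move=> /normalmxP/(congr1 trmx) nA; apply/normalmxP.
by move: nA; rewrite !trmx_mul -!map_trmx !trmxK.
Qed.

Lemma vN_entropy_trmx n (A : 'M[C]_n) :
  A \is normalmx -> vN_entropy A^T = vN_entropy A.
Proof.
move=> nA; apply: vN_entropy_char_poly; rewrite ?char_poly_trmx //.
exact: normalmx_trmx.
Qed.

Lemma gram_diag_ge0 m n (A : 'M[C]_(m, n)) i : 0 <= (A *m adjmx A) i i.
Proof.
by rewrite mxE sumr_ge0 // => j _; rewrite !mxE mul_conjC_ge0.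
Qed.

(** Diagonalizing [A A^*] by the unitary [P] yields the Gram matrix of [P A], whose diagonal is
    nonnegative. *)
Lemma spectral_diag_gram_ge0 m n (A : 'M[C]_(m, n)) i :
  0 <= spectral_diag (A *m adjmx A) 0 i.
Proof.
set B := A *m _; set P := spectralmx B.
have := gram_diag_ge0 (P *m A) i.
suff -> : P *m A *m adjmx (P *m A) = diag_mx (spectral_diag B).
  by rewrite mxE eqxx.
rewrite adjmx_mul -[adjmx P]invmx_unitary ?spectral_unitarymx //.
rewrite mulmxA -(mulmxA P).
exact/spectralmx_diag/normalmx_gram.
Qed.

Lemma ln2_gt0 : 0 < ln 2 :> R.
Proof. by rewrite ln_gt0 // ltr1n. Qed.

(** The left side is the tangent at [a] to the convex function [x log2 x]; the bound is
    [ln t <= t - 1] at [t = a / x], with [x = 0] treated apart. *)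
Lemma eta_tangent (a : R) (x : C) : 0 < a -> 0 <= x ->
  (complex.Re x - a) / ln 2 + complex.Re x * log2 a <= eta x.
Proof.
case: x => x y a0; rewrite lecE /= => /andP[_ x0]; rewrite /eta /log2 /=.
rewrite !mulrA -mulrDl ler_pM2r ?invr_gt0 ?ln2_gt0 //.
move: x0; rewrite le_eqVlt => /predU1P[<-|x0].
  by rewrite !mul0r sub0r addr0 lerNl oppr0 ltW.
have : ln (1 + (a / x - 1)) <= a / x - 1.
  by rewrite le_ln1Dx // ltrBDr addNr divr_gt0.
rewrite addrC subrK ln_div ?posrE // -(ler_pM2l x0).
rewrite !mulrBr mulrCA divff ?gt_eqF // !mulr1.
lra.
Qed.

(** The tangent bounds at [a = 1/m] are summed: the eigenvalues add up to 1, so the terms in [x - a]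
    cancel and [- log2 m] remains. *)
Lemma vN_entropy_le_log2 m n (A : 'M[C]_(m, n)) : (0 < m)%N ->
  \tr (A *m adjmx A) = 1 -> vN_entropy (A *m adjmx A) <= log2 m%:R.
Proof.
move=> m0; set B := _ *m _ => trB; have nB : B \is normalmx := normalmx_gram A.
have mR : 0 < m%:R :> R by rewrite ltr0n.
rewrite vN_entropyE // lerNl.
have sumD : \sum_i complex.Re (spectral_diag B 0 i) = 1.
  by rewrite -Re_sum -mxtrace_spectral // trB.
have a0 : 0 < m%:R^-1 :> R by rewrite invr_gt0.
apply: (le_trans _ (ler_sum _ (fun i _ =>
  eta_tangent a0 (spectral_diag_gram_ge0 A i)))).
rewrite big_split /= -!mulr_suml sumrB sumD sumr_const card_ord.
rewrite -[_^-1 *+ _]mulr_natl divff ?gt_eqF // subrr mul0r add0r mul1r.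
by rewrite /log2 lnV ?posrE // mulNr.
Qed.

End Spectrum.

(** * Positive semidefinite and Gram matrices *)

Section HermitianMatrices.
Variable R : realType.
Local Notation C := (R[i]).

Lemma adjmxE m n (A : 'M[C]_(m, n)) i j : adjmx A i j = (A j i)^*%R.
Proof. by rewrite !mxE. Qed.

(* Polarization: the real numbers q(e_i + e_j) and q(e_i + 'i e_j), where
   q(v) = v^* A v, determine A i j + A j i and 'i (A i j - A j i). *)
Lemma psdmx_herm n (A : 'M[C]_n) : psdmx A -> adjmx A = A.
Proof.
move=> psdA; pose q (v : 'cV_n) := (adjmx v *m A *m v) 0 0.
have q_real v : (q v)^* = q v by apply/CrealP/ger0_real/psdA.
pose e i : 'cV[C]_n := delta_mx i 0.
have adj_e i : adjmx (e i) = delta_mx 0 i.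
  by rewrite /adjmx trmx_delta map_delta_mx.
have e_form i j : (adjmx (e i) *m A *m e j) 0 0 = A i j.
  by rewrite adj_e -rowE -colE !mxE.
have q_pol i j c : q (e i + c *: e j) =
    A i i + c * A i j + (c^* * A j i + c^* * c * A j j).
  rewrite /q; have -> : adjmx (e i + c *: e j) = adjmx (e i) + c^* *: adjmx (e j).
    by apply/matrixP=> k l; rewrite !mxE rmorphD rmorphM.
  rewrite !mulmxDl !mulmxDr -!scalemxAl -!scalemxAr.
  have DE (X Y : 'M[C]_1) : (X + Y) 0 0 = X 0 0 + Y 0 0 by rewrite mxE.
  have ZE a (X : 'M[C]_1) : (a *: X) 0 0 = a * X 0 0 by rewrite mxE.
  by rewrite !(DE, ZE) !e_form mulrA.
have A_real i : (A i i)^* = A i i by rewrite -e_form; apply: q_real.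
apply/matrixP=> i j; rewrite adjmxE.
have := q_real (e i + 1 *: e j); have := q_real (e i + 'i *: e j).
rewrite !q_pol !rmorphD !rmorphM /= !conjCK !A_real conjC1 conjCi.
rewrite !mul1r !mulNr mulrN -!expr2 sqrCi => h1 h2.
(* Adding ['i] times the relation for [c = 1] to the one for [c = 'i] eliminates [A j i] and the
   conjugate of [A i j]. *)
suff : 2 * 'i * ((A j i)^* - A i j) = 0.
  move/eqP; rewrite !mulf_eq0 pnatr_eq0 (negPf (neq0Ci _)) subr_eq0.
  by move/eqP.
move/eqP: h1; rewrite -subr_eq0 => /eqP h1.
move/eqP: h2; rewrite -subr_eq0 => /eqP h2.
by rewrite -[RHS]addr0 -{1}h1 -[X in _ = _ + X](mulr0 'i) -h2; ring.
Qed.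

Lemma mxtrace_gram_eq0 m n (A : 'M[C]_(m, n)) :
  \tr (adjmx A *m A) = 0 -> A = 0.
Proof.
have E : \tr (adjmx A *m A) = \sum_i \sum_j `|A j i| ^+ 2.
  by apply: eq_bigr => i _; rewrite mxE; apply: eq_bigr => j _; rewrite !mxE normCKC.
rewrite E => /psumr_eq0P A0; apply/matrixP=> j i; rewrite mxE.
have /psumr_eq0P Ai0 : \sum_k `|A k i| ^+ 2 = 0.
  by apply: A0 => // k _; rewrite sumr_ge0 // => l _; rewrite exprn_ge0.
apply/eqP; rewrite -normr_eq0 -sqrf_eq0; apply/eqP/Ai0 => // k _.
by rewrite exprn_ge0.
Qed.

End HermitianMatrices.

(** * Conditional entropy through the post-measurement state *)

Section Measurements.
Variable R : realType.
Local Notation C := (R[i]).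

Lemma mxtens_index_bij m n : bijective (@mxtens_index m n).
Proof.
exists (@mxtens_unindex m n); [exact: mxtens_indexK | exact: mxtens_unindexK].
Qed.

Lemma sum_mxtens_index m n (F : 'I_(m * n) -> C) :
  \sum_p F p = \sum_(i < m) \sum_(k < n) F (mxtens_index (i, k)).
Proof.
rewrite (reindex _ (onW_bij _ (mxtens_index_bij m n))) pair_bigA.
by apply: eq_bigr => -[].
Qed.

Lemma mxtens_ext m n p q (X Y : 'M[C]_(m * n, p * q)) :
  (forall i k j l, X (mxtens_index (i, k)) (mxtens_index (j, l)) =
                   Y (mxtens_index (i, k)) (mxtens_index (j, l))) -> X = Y.
Proof.
move=> XY; apply/matrixP=> a b.
by case: (mxtens_indexP a) (mxtens_indexP b) => i k [j l].
Qed.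

(* Identifies C^d (x) C^e with the d x e matrices, |i>|k> being delta_mx i k. *)
Definition coef_mx d e (Psi : 'cV[C]_(d * e)) : 'M[C]_(d, e) :=
  \matrix_(i, k) Psi (mxtens_index (i, k)) 0.

Lemma ptrace2_ketbra d e (Psi : 'cV[C]_(d * e)) :
  ptrace2 (ketbra Psi) = coef_mx Psi *m adjmx (coef_mx Psi).
Proof.
apply/matrixP=> i j; rewrite !mxE; apply: eq_bigr => k _.
by rewrite mxE big_ord1 !mxE.
Qed.

Lemma tens_mulmx_cV d e (A : 'M[C]_d) (Psi : 'cV[C]_(d * e)) i k :
  ((A *t (1%:M : 'M_e)) *m Psi) (mxtens_index (i, k)) 0 = (A *m coef_mx Psi) i k.
Proof.
rewrite !mxE sum_mxtens_index; apply: eq_bigr => j _.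
rewrite (bigD1 k) //= big1 ?addr0 => [|l lk]; rewrite tensmxE !mxE.
  by rewrite eqxx mulr1.
by rewrite eq_sym (negPf lk) mulr0 mul0r.
Qed.

(** Entry [(k, l)] is the sum over [i] of [(A K)_(i, k)] times the conjugate of [K_(i, l)], where
    [l] is the row index of [K^*]; hence the transpose. *)
Lemma ptrace1_ketbra d e (A : 'M[C]_d) (Psi : 'cV[C]_(d * e)) :
  ptrace1 ((A *t 1%:M) *m ketbra Psi) =
  (adjmx (coef_mx Psi) *m A *m coef_mx Psi)^T.
Proof.
rewrite -mulmxA; apply/matrixP=> k l; rewrite !mxE; apply: eq_bigr => i _.
by rewrite mulmxA mxE big_ord1 tens_mulmx_cV !mxE mulrC.
Qed.

Section Outcome.
Variables (d e m : nat) (M : 'I_m -> 'M[C]_d) (Psi : 'cV[C]_(d * e)).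
Hypothesis measM : projective_measurement M.

Let K := coef_mx Psi.

(** Coefficient matrix, across the cut between [ZE] and [A], of the vector
    [sum_z |z> (M_z (x) 1) Psi], which purifies the classical-quantum state. *)
Definition outcome_mx : 'M[C]_(m * e, d) :=
  \matrix_(p, i) (M (mxtens_unindex p).1 *m K) i (mxtens_unindex p).2.
Local Notation G := outcome_mx.

Lemma outcome_mxE z k i : G (mxtens_index (z, k)) i = (M z *m K) i k.
Proof. by rewrite mxE mxtens_indexK. Qed.

Lemma meas_herm z : adjmx (M z) = M z.
Proof. by case: measM => psdM _ _; apply: psdmx_herm. Qed.

(** Orthogonality of the projectors is what makes the blocks of [G G^*] with [z != z'] vanish. *)
Lemma meas_gram z z' :
  adjmx (M z *m K) *m (M z' *m K) =
  if z == z' then adjmx K *m M z *m K else 0.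
Proof.
rewrite adjmx_mul meas_herm mulmxA -(mulmxA (adjmx K)).
case: measM => _ -> _; case: ifP => _ //.
by rewrite mulmx0 mul0mx.
Qed.

(** [p_z] is the trace of the Gram matrix of [M_z K], so zero probability forces [M_z K = 0]: the
    terms omitted from [cq_state] correspond to zero blocks of [G G^*]. *)
Lemma outcome_prob_eq0 z : outcome_prob M Psi z = 0 -> adjmx K *m M z *m K = 0.
Proof.
rewrite /outcome_prob ptrace2_ketbra -/K mulmxA mxtrace_mulC mulmxA => p0.
have := meas_gram z z; rewrite eqxx => eqM; rewrite -eqM in p0 *.
by rewrite (mxtrace_gram_eq0 p0) mulmx0.
Qed.

Lemma cq_stateE : cq_state M Psi = G *m adjmx G.
Proof.
apply: mxtens_ext => z k z' l; rewrite [RHS]mxE.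
transitivity ((adjmx (M z' *m K) *m (M z *m K)) l k); last first.
  by rewrite mxE; apply: eq_bigr => i _; rewrite !adjmxE !outcome_mxE mulrC.
rewrite meas_gram /cq_state summxE.
have E w : outcome_prob M Psi w != 0 ->
  (outcome_prob M Psi w *: (delta_mx w w *t cond_state M Psi w))
    (mxtens_index (z, k)) (mxtens_index (z', l)) =
  ((z == w) && (z' == w))%:R * (adjmx K *m M w *m K) l k.
  move=> pw; rewrite mxE tensmxE mxE /cond_state ptrace1_ketbra.
  by rewrite mxE mulrCA mulVKf // mxE.
rewrite (eq_bigr _ E); have [->|neq] := eqVneq z' z; last first.
  rewrite big1 ?mxE // => w _; case: eqP => [<-|_]; last by rewrite mul0r.
  by rewrite (negPf neq) mul0r.
rewrite big_mkcond (bigD1 z) //= big1 ?addr0 => [|w wz]; last first.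
  by rewrite [z == w]eq_sym (negPf wz) mul0r if_same.
rewrite eqxx mul1r; case: eqP => [/outcome_prob_eq0->|//].
by rewrite mxE.
Qed.

(** Since [sum_z M_z = 1], measuring [A] leaves Eve's marginal unchanged. *)
Lemma ptrace1_cq_state : ptrace1 (cq_state M Psi) = (adjmx K *m K)^T.
Proof.
case: (measM) => _ _ sumM.
rewrite cq_stateE -{2}[K]mul1mx -sumM mulmx_suml mulmx_sumr.
apply/matrixP=> k l; rewrite mxE [RHS]mxE summxE; apply: eq_bigr => z _.
have := meas_gram z z; rewrite eqxx -mulmxA => <-; rewrite [LHS]mxE [RHS]mxE.
by apply: eq_bigr => i _; rewrite !adjmxE !outcome_mxE mulrC.
Qed.

Lemma outcome_gram :
  adjmx G *m G = (\sum_z M z *m (K *m adjmx K) *m M z)^T.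
Proof.
apply/matrixP=> i j; rewrite !mxE sum_mxtens_index summxE.
apply: eq_bigr => z _; rewrite -{2}meas_herm -!mulmxA -adjmx_mul mulmxA mxE.
by apply: eq_bigr => k _; rewrite !adjmxE !outcome_mxE mulrC.
Qed.

(** Each term passes to the opposite Gram product, and transposition preserves entropy. The result
    depends on [Psi] only through its marginal on [A]. *)
Lemma cond_entropyE :
  cond_entropy M Psi =
  vN_entropy (\sum_z M z *m ptrace2 (ketbra Psi) *m M z)
  - vN_entropy (ptrace2 (ketbra Psi)).
Proof.
rewrite ptrace2_ketbra -/K /cond_entropy; congr (_ - _).
  rewrite cq_stateE vN_entropy_gramC outcome_gram vN_entropy_trmx //.
  by rewrite -[X in X \is _]trmxK normalmx_trmx // -outcome_gram normalmx_gramC.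
by rewrite ptrace1_cq_state vN_entropy_trmx ?normalmx_gramC // vN_entropy_gramC.
Qed.

End Outcome.

End Measurements.

(* The discrete Fourier transform. *)
Lemma unitarymx_flat_exists (C : numClosedFieldType) n : (n > 0)%N ->
  exists2 F : 'M[C]_n, F \is unitarymx & forall i j, `|F i j| ^+ 2 = n%:R^-1.
Proof.
move=> n0; have [w prim_w] := prim_root_exists C n0.
have w1 : `|w| = 1.
  by apply/eqP; rewrite -(pexpr_eq1 n0) // -normrX (prim_expr_order prim_w) normr1.
have nR : n%:R != 0 :> C by rewrite pnatr_eq0 -lt0n.
pose s : C := (sqrtC n%:R)^-1.
have ss : s * s^* = n%:R^-1.
  by rewrite -normCK normfV ger0_norm ?sqrtC_ge0 ?ler0n // exprVn sqrtCK.
exists (\matrix_(i, j) (s * w ^+ (i * j))) => [|i j]; last first.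
  by rewrite mxE normCK rmorphM mulrACA ss -normCK normrX w1 !expr1n mulr1.
have wN0 : w != 0 by rewrite -normr_eq0 w1 oner_eq0.
have wC : w^* = w^-1 by rewrite -[RHS]mulr1 -(expr1n _ 2) -w1 normCK mulKf.
apply/unitarymxP/matrixP=> i k; rewrite !mxE.
pose x := w ^+ i / w ^+ k.
transitivity (n%:R^-1 * \sum_(j < n) x ^+ j).
  rewrite mulr_sumr; apply: eq_bigr => j _.
  by rewrite !mxE rmorphM rmorphXn /= wC mulrACA ss /x exprMn !exprVn !exprM.
have [eq_ik|ik] := eqVneq i k.
  rewrite (eq_bigr (fun=> 1)) ?sumr_const ?card_ord ?mulVf // => j _.
  by rewrite /x eq_ik divff ?expf_neq0 // expr1n.
suff -> : \sum_(j < n) x ^+ j = 0 by rewrite mulr0.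
(* Both exponents lie below the order [n] of [w], so [x != 1], and the geometric sum vanishes
   because [x^n = 1]. *)
have x1 : x - 1 != 0.
  rewrite subr_eq0; apply: contra ik => /eqP x1; apply/eqP/val_inj => /=.
  have /eqP : w ^+ i = w ^+ k by rewrite -[RHS]mul1r -x1 divfK ?expf_neq0.
  by rewrite (eq_prim_root_expr prim_w) !modn_small // => /eqP.
apply: (mulfI x1); rewrite -subrX1 mulr0 /x exprMn exprVn -!exprM mulnC exprM.
by rewrite (mulnC k) exprM (prim_expr_order prim_w) !expr1n invr1 mulr1 subrr.
Qed.

(** * A measurement unbiased with respect to the eigenbasis *)

Section Extremal.
Variable R : realType.
Local Notation C := (R[i]).

(** The measured vectors are the adjoints of the rows of [W], the convention by which [spectralmx]
    lists eigenvectors. *)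
Definition basis_measurement n (W : 'M[C]_n) (z : 'I_n) : 'M[C]_n :=
  adjmx (row z W) *m row z W.

Lemma adjmx_unitaryl n (W : 'M[C]_n) : W \is unitarymx -> adjmx W *m W = 1%:M.
Proof. by move/unitarymxP/mulmx1C. Qed.

Lemma sum_basis_measurement n (W : 'M[C]_n) :
  \sum_z basis_measurement W z = adjmx W *m W.
Proof.
apply/matrixP=> i j; rewrite summxE mxE; apply: eq_bigr => z _.
by rewrite mxE big_ord1 !mxE.
Qed.

(** In scalar form, this 1 x 1 product can be pulled out of products of rank one projectors. *)
Lemma row_sandwich n (W X : 'M[C]_n) z z' :
  row z W *m X *m adjmx (row z' W) = ((W *m X *m adjmx W) z z')%:M.
Proof.
rewrite [LHS]mx11_scalar; congr (_%:M); rewrite -row_mul !mxE.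
by apply: eq_bigr => j _; rewrite !mxE.
Qed.

Lemma basis_measurementP n (W : 'M[C]_n) : W \is unitarymx ->
  projective_measurement (basis_measurement W).
Proof.
move=> uW; split=> [z v|z z'|]; last by rewrite sum_basis_measurement adjmx_unitaryl.
  rewrite /basis_measurement mulmxA -adjmx_mul -mulmxA.
  by rewrite -{2}[_ *m v]adjmxK gram_diag_ge0.
rewrite /basis_measurement mulmxA -(mulmxA (adjmx _)) -[row z W]mulmx1.
rewrite row_sandwich !mulmx1 (unitarymxP uW) mxE mul_mx_scalar -scalemxAl.
by case: eqVneq => [->|_]; rewrite ?scale1r ?scale0r.
Qed.

(** For [W = F V], with [V] diagonalizing [B = A A^*] to [D], the diagonal entries of
    [W B W^* = F D F^*] are [sum_j |F_(z, j)|^2 D_j], the mean of the eigenvalues. *)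
Lemma flat_measurement_exists n (m : nat) (A : 'M[C]_(n, m)) : (0 < n)%N ->
  exists2 M : 'I_n -> 'M[C]_n, projective_measurement M &
    \sum_z M z *m (A *m adjmx A) *m M z =
    (n%:R^-1 * \tr (A *m adjmx A))%:M.
Proof.
set B := A *m _ => n0; have nB : B \is normalmx := normalmx_gram A.
have [F uF flatF] := unitarymx_flat_exists C n0.
set V := spectralmx B; have uV : V \is unitarymx := spectral_unitarymx B.
have uW : F *m V \is unitarymx by apply: mul_unitarymx.
exists (basis_measurement (F *m V)); first exact: basis_measurementP.
transitivity (\sum_z (n%:R^-1 * \tr B) *: basis_measurement (F *m V) z); last first.
  by rewrite -scaler_sumr sum_basis_measurement adjmx_unitaryl // scalemx1.
apply: eq_bigr => z _; rewrite /basis_measurement; set r := row z _.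
have -> : adjmx r *m r *m B *m (adjmx r *m r) = adjmx r *m (r *m B *m adjmx r) *m r.
  by rewrite !mulmxA.
rewrite row_sandwich mul_mx_scalar -scalemxAl; congr (_ *: _).
have adjV : adjmx V = invmx V by rewrite invmx_unitary.
have -> : F *m V *m B *m adjmx (F *m V) =
    F *m diag_mx (spectral_diag B) *m adjmx F.
  by rewrite -(spectralmx_diag nB) -/V adjmx_mul adjV !mulmxA.
rewrite mul_mx_diag mxE (mxtrace_spectral nB) mulr_sumr.
by apply: eq_bigr => j _; rewrite !mxE mulrAC -normCK flatF.
Qed.

End Extremal.

Theorem theorem2 (R : realType) (d e : nat)
    (rho : 'M[R[i]]_d) (Psi : 'cV[R[i]]_(d * e))
    (Hrho : quantum_state rho) (HPsi : purification rho Psi) :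
  (exists (m : nat) (M : 'I_m -> 'M[R[i]]_d),
      projective_measurement M /\
      cond_entropy M Psi = log2 (d%:R : R) - vN_entropy rho) /\
  (forall (m : nat) (M : 'I_m -> 'M[R[i]]_d),
      projective_measurement M ->
      cond_entropy M Psi <= log2 (d%:R : R) - vN_entropy rho).
Proof.
case: Hrho HPsi => _ tr1 [_ eq_rho].
have d0 : (0 < d)%N.
  case: (posnP d) => // d0; move: tr1; subst d.
  by rewrite /mxtrace big_ord0 => /eqP; rewrite eq_sym oner_eq0.
have dR : 0 < d%:R :> R by rewrite ltr0n.
have eq_gram := ptrace2_ketbra Psi; rewrite eq_rho in eq_gram.
split=> [|m M measM].
  (* As [tr rho = 1], this measurement produces the state [1/d], of entropy [log2 d]. *)
  have [M measM sumM] := flat_measurement_exists (coef_mx Psi) d0.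
  exists d, M; split; first exact: measM.
  rewrite (cond_entropyE _ measM) eq_rho; congr (_ - _).
  rewrite eq_gram sumM -eq_gram tr1 mulr1.
  have -> : d%:R^-1 = (d%:R^-1)%:C%C :> R[i] by rewrite fmorphV rmorph_nat.
  rewrite vN_entropy_scalar mulrA divff ?gt_eqF // mul1r.
  by rewrite /log2 lnV ?posrE // mulNr opprK.
rewrite (cond_entropyE _ measM) eq_rho lerD2r; set N := \sum_z _.
have := outcome_gram Psi measM; rewrite -eq_gram -/N.
set G := outcome_mx _ _ => eqG.
have nN : N \is normalmx.
  by rewrite -[N]trmxK normalmx_trmx // -eqG normalmx_gramC.
(* [N^T] is the Gram matrix of [G^*], which has [d] rows, so the bound is [log2 d]. *)
rewrite -vN_entropy_trmx // -eqG -{2}[G]adjmxK vN_entropy_le_log2 //.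
(* It remains that [tr N = tr rho], by cyclicity, [M_z^2 = M_z] and completeness. *)
rewrite adjmxK eqG mxtrace_tr -tr1 raddf_sum /=.
case: measM => _ MM sumM; rewrite -[in RHS](mul1mx rho) -sumM mulmx_suml raddf_sum.
apply: eq_bigr => z _ /=.
by rewrite mxtrace_mulC mulmxA MM eqxx.
Qed.
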